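(* Let $0<q<1$ and let $f:(0,\infty)\times(0,\infty)\to\mathbb{R}$ satisfy (i) $f(x+1,y+1)=\dfrac{(1-q^x)(1-q^y)}{(1-q^{x+y})(1-q^{x+y+1})}\,f(x,y)$ for all $x,y>0$; (ii) for some $M\ge 0$, $f(x,y)<f(u,v)$ whenever $x>u>M$ and $y>v>M$; (iii) $f(1,1)=1$. Then $f(x,y)=B_q(x,y)$ for all $x,y>0$.
   Context: For $0<q<1$ and $x,y>0$, the $q$-beta function is $B_q(x,y)=\frac{\Gamma_q(x)\Gamma_q(y)}{\Gamma_q(x+y)}$, where $\Gamma_q(x)=\frac{(q;q)_\infty}{(q^x;q)_\infty}(1-q)^{1-x}$ and $(a;q)_\infty=\prod_{k=0}^\infty(1-aq^k)$. *)

(* Defs.v *)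
From mathcomp Require Import all_boot all_order all_algebra.
From mathcomp Require Import all_classical all_reals all_analysis.

Set Implicit Arguments.
Unset Strict Implicit.
Unset Printing Implicit Defensive.

Import Order.TTheory GRing.Theory Num.Theory.
Import numFieldNormedType.Exports.
Local Open Scope classical_set_scope.
Local Open Scope ring_scope.

(* [lim] is total: for [`|q| < 1] the partial products converge and this is
   the infinite product (a;q)_oo; otherwise the value may be junk. *)
Definition qpoch_inf (R : realType) (a q : R) : R :=
  lim ((\prod_(0 <= k < n) (1 - a * q ^+ k)) @[n --> \oo]).

Definition qgamma (R : realType) (q x : R) : R :=
  qpoch_inf q q / qpoch_inf (q `^ x) q * (1 - q) `^ (1 - x).

Definition qbeta (R : realType) (q x y : R) : R :=
  qgamma q x * qgamma q y / qgamma q (x + y).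

(* Main.v *)
Require Import Defs.
From mathcomp Require Import all_boot all_order all_algebra.
From mathcomp Require Import all_classical all_reals all_analysis.
From mathcomp Require Import ring lra.

Import Order.TTheory GRing.Theory Num.Theory.
Import numFieldNormedType.Exports.
Local Open Scope ring_scope.

(** Iterating the recurrence gives
    [f (x+n, y+n) = f (x, y) (q^x;q)_n (q^y;q)_n / (q^(x+y);q)_(2n)], so
    [f (x+n, y+n)] converges.  By monotonicity this sequence interlaces with
    [f (1+n, 1+n)] up to a shift of the index, so the limit does not depend on
    [(x, y)]; computing it at [(1, 1)] determines [f]. *)

(** Spelled exactly as the sequence under [lim] in [qpoch_inf], so that [cvg_qpoch] holds by mere
    conversion from convergence. *)
Definition qpoch {R : realType} (a q : R) (n : nat) : R :=
  \prod_(0 <= k < n) (1 - a * q ^+ k).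

Section qpochhammer.
Set Implicit Arguments.
Unset Strict Implicit.
Local Open Scope classical_set_scope.
Local Open Scope ring_scope.
Context {R : realType}.
Implicit Types a q x y : R.

Lemma qpoch0 a q : qpoch a q 0 = 1.
Proof. by rewrite /qpoch big_nil. Qed.

Lemma qpochSr a q n : qpoch a q n.+1 = qpoch a q n * (1 - a * q ^+ n).
Proof. by rewrite /qpoch big_nat_recr. Qed.

Lemma qpochSl a q n : qpoch a q n.+1 = (1 - a) * qpoch (a * q) q n.
Proof.
rewrite /qpoch big_nat_recl //= expr0 mulr1; congr (_ * _).
by apply: eq_bigr => k _; rewrite exprS mulrA.
Qed.

Lemma qpochD a q m n :
  qpoch a q (m + n) = qpoch a q m * qpoch (a * q ^+ m) q n.
Proof.
elim: m a => [|m IH] a; first by rewrite qpoch0 mul1r expr0 mulr1.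
by rewrite addSn !qpochSl IH exprS mulrA mulrA.
Qed.

Section convergence.
Variable q : R.
Hypotheses (q0 : 0 < q) (q1 : q < 1).

Lemma mulqX_lt1 a n : 0 <= a < 1 -> 0 <= a * q ^+ n < 1.
Proof.
case/andP=> a0 a1; rewrite mulr_ge0 ?exprn_ge0 ?(ltW q0)//=.
by apply: le_lt_trans a1; rewrite ler_piMr// exprn_ile1// ltW.
Qed.

Lemma qpoch_gt0 a n : 0 <= a < 1 -> 0 < qpoch a q n.
Proof.
move=> a01; elim: n => [|n IH]; first by rewrite qpoch0.
by rewrite qpochSr mulr_gt0// subr_gt0; case/andP: (mulqX_lt1 n a01).
Qed.

(** Weierstrass product inequality with the geometric sum of the [a * q ^+ k] bounded by
    [a / (1 - q)]. Peeling off the first factor replaces [a] by [a * q], and (1 - a)(1 - t) >= 1 -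
    (a + t) for a, t >= 0. The bound is uniform in [n]. *)
Lemma qpoch_ge a n : 0 <= a < 1 -> 1 - a / (1 - q) <= qpoch a q n.
Proof.
elim: n a => [|n IH] a a01.
  by rewrite qpoch0 lerBlDr lerDl divr_ge0 ?subr_ge0 ?(ltW q1)//; case/andP: a01.
have := mulqX_lt1 1 a01; rewrite expr1 => /[dup] aq01 /andP[aq0 _].
case/andP: a01 => a0 a1; rewrite qpochSl.
apply: (@le_trans _ _ ((1 - a) * (1 - a * q / (1 - q)))); last first.
  by rewrite ler_pM2l ?subr_gt0// IH.
have -> : a / (1 - q) = a + a * q / (1 - q).
  by field; rewrite subr_eq0 gt_eqF.
have : 0 <= a * q / (1 - q) by rewrite divr_ge0// subr_ge0 ltW.
by move: (a * q / (1 - q)) => t t0; nra.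
Qed.

Lemma is_cvg_qpoch a : 0 <= a < 1 -> cvgn (qpoch a q).
Proof.
move=> a01; apply: nonincreasing_is_cvgn.
  apply/nonincreasing_seqP => n; rewrite qpochSr.
  rewrite ler_piMr ?(ltW (qpoch_gt0 _ a01))// gerBl.
  by case/andP: (mulqX_lt1 n a01).
by exists 0 => _ [n _ <-]; rewrite ltW// qpoch_gt0.
Qed.

Lemma cvg_qpoch a : 0 <= a < 1 -> qpoch a q @ \oo --> qpoch_inf a q.
Proof. exact: is_cvg_qpoch. Qed.

(** Positive partial products alone only give a nonnegative limit; [qpoch_ge], applied to the tail,
    keeps them away from 0. *)
Lemma qpoch_inf_gt0 a : 0 <= a < 1 -> 0 < qpoch_inf a q.
Proof.
move=> a01; have /andP[a0 a1] := a01.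
(* Past a large index the factors deviate from 1 by less than 1/2 in total. *)
have [m am] : exists m, a * q ^+ m / (1 - q) <= 2^-1.
  have q01 : `|q| < 1 by rewrite ger0_norm ?(ltW q0).
  have c0 : 0 < (1 - q) / 2 by rewrite divr_gt0// subr_gt0.
  have /cvgrPdist_lt/(_ _ c0)[m _ /(_ m (leqnn m))] /= := cvg_expr q01.
  rewrite sub0r normrN ger0_norm ?exprn_ge0 ?(ltW q0)// => qm; exists m.
  rewrite ler_pdivrMr ?subr_gt0// [leRHS]mulrC; apply: le_trans (ltW qm).
  by rewrite ler_piMl ?exprn_ge0 ?(ltW q0)// ltW.
apply: (@lt_le_trans _ _ (qpoch a q m / 2)); first by rewrite divr_gt0 ?qpoch_gt0.
apply: limr_ge; first exact: is_cvg_qpoch.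
exists m => // n /= mn; rewrite -/(qpoch a q n) -(subnKC mn) qpochD.
rewrite ler_pM2l ?qpoch_gt0//.
by apply: le_trans (qpoch_ge _ (mulqX_lt1 m a01)); lra.
Qed.

Lemma qpoch_infS a : 0 <= a < 1 ->
  qpoch_inf a q = (1 - a) * qpoch_inf (a * q) q.
Proof.
move=> a01; have := mulqX_lt1 1 a01; rewrite expr1 => aq01.
have := cvg_qpoch a01; rewrite -(cvg_shiftn 1).
have -> : [sequence qpoch a q (n + 1)]_n = (fun n => (1 - a) * qpoch (a * q) q n).
  by apply/funext => n; rewrite /= addn1 qpochSl.
move=> h; apply: (cvg_unique _ h) => //.
by apply: cvgMr; exact: cvg_qpoch.
Qed.

Lemma powR_lt1 x : 0 < x -> 0 <= q `^ x < 1.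
Proof.
move=> x0; rewrite powR_ge0 /= /powR gt_eqF// -expR0 ltr_expR.
by rewrite pmulr_rlt0// ln_lt0// q0.
Qed.

Lemma qbetaE x y : 0 < x -> 0 < y ->
  qbeta q x y = (1 - q) * qpoch_inf q q * qpoch_inf (q `^ (x + y)) q
                / (qpoch_inf (q `^ x) q * qpoch_inf (q `^ y) q).
Proof.
move=> x0 y0; rewrite /qbeta /qgamma.
have Q0 : qpoch_inf q q != 0 by rewrite gt_eqF// qpoch_inf_gt0// q1 ltW.
have Qx : qpoch_inf (q `^ x) q != 0 by rewrite gt_eqF// qpoch_inf_gt0// powR_lt1.
have Qy : qpoch_inf (q `^ y) q != 0 by rewrite gt_eqF// qpoch_inf_gt0// powR_lt1.
have Qxy : qpoch_inf (q `^ (x + y)) q != 0.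
  by rewrite gt_eqF// qpoch_inf_gt0// powR_lt1// addr_gt0.
have p0 : 1 - q != 0 by rewrite subr_eq0 gt_eqF.
have P0 : (1 - q) `^ (1 - (x + y)) != 0 by rewrite gt_eqF// powR_gt0// subr_gt0.
(* The exponents 1 - x and 1 - y exceed 1 - (x + y) by 1 in total, which leaves a single factor 1 -
   q. *)
have : (1 - q) `^ (1 - x) * (1 - q) `^ (1 - y)
       = (1 - q) * (1 - q) `^ (1 - (x + y)).
  rewrite -[X in _ = X * _]powRr1 ?subr_ge0 ?(ltW q1)//.
  by rewrite -!powRD ?p0 ?implybT//; congr (_ `^ _); ring.
move: ((1 - q) `^ (1 - x)) ((1 - q) `^ (1 - y)) ((1 - q) `^ (1 - (x + y))) P0.
move=> A B C C0 ABC.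
transitivity (A * B * qpoch_inf q q * qpoch_inf (q `^ (x + y)) q /
  (C * qpoch_inf (q `^ x) q * qpoch_inf (q `^ y) q)).
  by field; do ?[apply/andP; split].
by rewrite ABC; field; do ?[apply/andP; split].
Qed.

(** Each step raises x + y by 2 and so uses up two consecutive factors of the denominator, whence
    the index [n + n]. *)
Lemma beta_rec_iter (f : R -> R -> R) :
  (forall x y, 0 < x -> 0 < y ->
    f (x + 1) (y + 1) =
      (1 - q `^ x) * (1 - q `^ y)
        / ((1 - q `^ (x + y)) * (1 - q `^ (x + y + 1))) * f x y) ->
  forall x y n, 0 < x -> 0 < y ->
    f (x + n%:R) (y + n%:R) =
      qpoch (q `^ x) q n * qpoch (q `^ y) q n
        / qpoch (q `^ (x + y)) q (n + n) * f x y.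
Proof.
move=> frec x y n x0 y0; elim: n => [|n IH].
  by rewrite !addr0 !qpoch0 mulr1 divr1 mul1r.
have qn0 : q != 0 by rewrite gt_eqF.
have powq z m : q `^ (z + m%:R) = q `^ z * q ^+ m.
  by rewrite powRD ?qn0 ?implybT// powR_mulrn// ltW.
rewrite -natr1 !addrA frec ?ltr_wpDr// IH addSn addnS !qpochSr.
have -> : x + n%:R + (y + n%:R) = x + y + (n + n)%:R by rewrite natrD; ring.
rewrite -[_ + (n + n)%:R + 1]addrA natr1 !powq !invfM; ring.
Qed.

Lemma cvg_beta_rec (f : R -> R -> R) :
  (forall x y, 0 < x -> 0 < y ->
    f (x + 1) (y + 1) =
      (1 - q `^ x) * (1 - q `^ y)
        / ((1 - q `^ (x + y)) * (1 - q `^ (x + y + 1))) * f x y) ->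
  forall x y, 0 < x -> 0 < y ->
    (fun n : nat => f (x + n%:R) (y + n%:R)) @ \oo -->
      qpoch_inf (q `^ x) q * qpoch_inf (q `^ y) q
        / qpoch_inf (q `^ (x + y)) q * f x y.
Proof.
move=> frec x y x0 y0; under eq_fun do rewrite beta_rec_iter//.
have xy0 : 0 < x + y by rewrite addr_gt0.
apply: cvgM; last exact: cvg_cst.
apply: cvgM; first by apply: cvgM; apply: cvg_qpoch; exact: powR_lt1.
apply: cvgV; first by rewrite gt_eqF// qpoch_inf_gt0// powR_lt1.
(* The denominator runs along the even-indexed partial products, which have the same limit. *)
have c : (fun n => n + n)%N @ \oo --> \oo.
  by move=> A [N _ NA]; exists N => // n /= Nn; apply: NA; exact: leq_trans (leq_addr _ _).
by apply: (cvg_comp _ _ c); apply: cvg_qpoch; exact: powR_lt1.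
Qed.

End convergence.
End qpochhammer.

Theorem theorem6p6 (R : realType) (q : R) (hq0 : 0 < q) (hq1 : q < 1)
    (f : R -> R -> R)
    (hrec : forall x y : R, 0 < x -> 0 < y ->
      f (x + 1) (y + 1) =
        (1 - q `^ x) * (1 - q `^ y)
          / ((1 - q `^ (x + y)) * (1 - q `^ (x + y + 1))) * f x y)
    (hdec : exists M : R, 0 <= M /\
      forall x y u v : R, M < u -> u < x -> M < v -> v < y -> f x y < f u v)
    (h11 : f 1 1 = 1) :
  forall x y : R, 0 < x -> 0 < y -> f x y = qbeta q x y.
Proof.
move=> x y x0 y0; have [M [_ fdec]] := hdec.
have q01 : 0 <= q < 1 by rewrite hq1 ltW.
have Qx : qpoch_inf (q `^ x) q != 0 by rewrite gt_eqF// qpoch_inf_gt0// powR_lt1.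
have Qy : qpoch_inf (q `^ y) q != 0 by rewrite gt_eqF// qpoch_inf_gt0// powR_lt1.
have Qxy : qpoch_inf (q `^ (x + y)) q != 0.
  by rewrite gt_eqF// qpoch_inf_gt0// powR_lt1// addr_gt0.
have cxy := cvg_beta_rec hq0 hq1 hrec x0 y0.
have c11 := cvg_beta_rec hq0 hq1 hrec (@ltr01 R) (@ltr01 R).
(* At (1, 1) the limit is (q;q)^2 / (q^2;q) with infinite products, and (q;q) = (1 - q) (q^2;q)
   cancels the denominator. *)
have L11 : qpoch_inf (q `^ 1) q * qpoch_inf (q `^ 1) q
           / qpoch_inf (q `^ (1 + 1)) q * f 1 1 = (1 - q) * qpoch_inf q q.
  have E : q `^ (1 + 1) = q * q by rewrite (powR_mulrn 2) ?expr2// ltW.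
  rewrite h11 E powRr1 ?(ltW hq0)// mulr1 {1}(qpoch_infS hq0 hq1 q01).
  have : qpoch_inf (q * q) q != 0.
    by rewrite gt_eqF// qpoch_inf_gt0// -[X in q * X]expr1 mulqX_lt1.
  by move=> ?; field.
rewrite L11 in c11.
suff L : qpoch_inf (q `^ x) q * qpoch_inf (q `^ y) q
         / qpoch_inf (q `^ (x + y)) q * f x y = (1 - q) * qpoch_inf q q.
  rewrite qbetaE// -L; field; by do ?[apply/andP; split].
have bigM : (\forall n \near \oo, M < n%:R)%classic by exact: nbhs_infty_gtr.
apply/eqP; rewrite eq_le; apply/andP; split.
(* A shift by 1 suffices: x + n + 1 > 1 + n and y + n + 1 > 1 + n, so [f] is smaller along the
   shifted sequence. *)
- have := cxy; rewrite -(cvg_shiftn 1) => cxy1.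
  apply: (ler_cvg_to cxy1 c11); near=> n => /=; apply: ltW.
  have Mn : M < n%:R by near: n.
  by apply: fdec; rewrite ?natrD; lra.
(* Since x, y > 0, an integer above x + y exceeds both, so 1 + n + m lies beyond x + n and y + n;
   this gives the reverse inequality. *)
- pose m := (Num.trunc (x + y)).+1.
  have xym : x + y < m%:R by apply: truncnS_gt.
  have := c11; rewrite -(cvg_shiftn m) => c11m.
  apply: (ler_cvg_to c11m cxy); near=> n => /=; apply: ltW.
  have Mn : M < n%:R by near: n.
  by apply: fdec; rewrite ?natrD; lra.
Unshelve. all: by end_near.
Qed.
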